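(* Let $\bar{\mathbf v}\in\mathbb C^{N(K+J)}$ be nonzero. The first-order optimality condition of the problem $$\underset{\bar{\mathbf v}}{\text{maximize}}\;\; L(\bar{\mathbf v})=\sum_{k=1}^{K}\left\{\log_2\left(\frac{\bar{\mathbf v}^{\mathsf H}\mathbf A_k\bar{\mathbf v}}{\bar{\mathbf v}^{\mathsf H}\mathbf B_k\bar{\mathbf v}}\right)-\alpha\log\left(\sum_{m=1}^{M}\left(\frac{\bar{\mathbf v}^{\mathsf H}\mathbf C_{m,k}\bar{\mathbf v}}{\bar{\mathbf v}^{\mathsf H}\mathbf D_{m,k}\bar{\mathbf v}}\right)^{\beta}\right)\right\},\qquad \beta=\frac{1}{\alpha\log 2},$$ that is, $\partial L(\bar{\mathbf v})/\partial\bar{\mathbf v}^{\mathsf H}=\mathbf 0$, is satisfied at $\bar{\mathbf v}$ if $$\mathbf B_{\mathsf{KKT}}^{-1}(\bar{\mathbf v})\,\mathbf A_{\mathsf{KKT}}(\bar{\mathbf v})\,\bar{\mathbf v}=\lambda(\bar{\mathbf v})\,\bar{\mathbf v},$$ where $\lambda(\bar{\mathbf v})=\lambda_{\mathsf{num}}(\bar{\mathbf v})/\lambda_{\mathsf{den}}(\bar{\mathbf v})$, $$\lambda_{\mathsf{num}}(\bar{\mathbf v})=\prod_{k=1}^{K}\left(\bar{\mathbf v}^{\mathsf H}\mathbf A_k\bar{\mathbf v}\right),\qquad \lambda_{\mathsf{den}}(\bar{\mathbf v})=\prod_{k=1}^{K}\left(\sum_{m=1}^{M}\left(\frac{\bar{\mathbf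 v}^{\mathsf H}\mathbf C_{m,k}\bar{\mathbf v}}{\bar{\mathbf v}^{\mathsf H}\mathbf D_{m,k}\bar{\mathbf v}}\right)^{\beta}\right)^{\alpha}\left(\bar{\mathbf v}^{\mathsf H}\mathbf B_k\bar{\mathbf v}\right),$$ $$\mathbf A_{\mathsf{KKT}}(\bar{\mathbf v})=\lambda_{\mathsf{num}}(\bar{\mathbf v})\sum_{k=1}^{K}\left(\frac{1}{\log 2}\frac{\mathbf A_k}{\bar{\mathbf v}^{\mathsf H}\mathbf A_k\bar{\mathbf v}}+\frac{\alpha\sum_{m=1}^M\beta\left(\frac{\bar{\mathbf v}^{\mathsf H}\mathbf C_{m,k}\bar{\mathbf v}}{\bar{\mathbf v}^{\mathsf H}\mathbf D_{m,k}\bar{\mathbf v}}\right)^{\beta}\frac{\mathbf D_{m,k}}{\bar{\mathbf v}^{\mathsf H}\mathbf D_{m,k}\bar{\mathbf v}}}{\sum_{m=1}^M\left(\frac{\bar{\mathbf v}^{\mathsf H}\mathbf C_{m,k}\bar{\mathbf v}}{\bar{\mathbf v}^{\mathsf H}\mathbf D_{m,k}\bar{\mathbf v}}\right)^{\beta}}\right),$$ $$\mathbf B_{\mathsf{KKT}}(\bar{\mathbf v})=\lambda_{\mathsf{den}}(\bar{\mathbf v})\sum_{k=1}^{K}\left(\frac{1}{\log 2}\frac{\mathbf B_k}{\bar{\mathbf v}^{\mathsf H}\mathbf B_k\bar{\mathbf v}}+\frac{\alpha\sum_{m=1}^M\beta\left(\frac{\bar{\mathbf v}^{\mathsf H}\mathbf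 C_{m,k}\bar{\mathbf v}}{\bar{\mathbf v}^{\mathsf H}\mathbf D_{m,k}\bar{\mathbf v}}\right)^{\beta}\frac{\mathbf C_{m,k}}{\bar{\mathbf v}^{\mathsf H}\mathbf C_{m,k}\bar{\mathbf v}}}{\sum_{m=1}^M\left(\frac{\bar{\mathbf v}^{\mathsf H}\mathbf C_{m,k}\bar{\mathbf v}}{\bar{\mathbf v}^{\mathsf H}\mathbf D_{m,k}\bar{\mathbf v}}\right)^{\beta}}\right).$$
   Context: $N,K,M\ge 1$ and $J\ge 0$ are integers; $P,\sigma^2,\sigma_{\mathsf e}^2,\alpha>0$ are real numbers; $\mathbf h_1,\dots,\mathbf h_K\in\mathbb C^N$ (user channels) and $\mathbf g_1,\dots,\mathbf g_M\in\mathbb C^N$ (eavesdropper channels) are given vectors. $\log$ is the natural logarithm, $\log_2$ the base-2 logarithm, $(\cdot)^{\mathsf H}$ the conjugate transpose, $\mathbf I_n$ the $n\times n$ identity. For $k=1,\dots,K$ and $m=1,\dots,M$, define the $N(K+J)\times N(K+J)$ block-diagonal matrices (with $K+J$ diagonal blocks of size $N\times N$) $$\mathbf A_k=\mathrm{blkdiag}(\mathbf h_k\mathbf h_k^{\mathsf H},\dots,\mathbf h_k\mathbf h_k^{\mathsf H})+\tfrac{\sigma^2}{P}\mathbf I_{N(K+J)},\qquad \mathbf B_k=\mathbf A_k-\mathrm{blkdiag}(\mathbf 0,\dots,\mathbf h_k\mathbf h_k^{\mathsf H},\dots,\mathbf 0),$$ $$\mathbf C_{m,k}=\mathrm{blkdiag}(\mathbf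 g_m\mathbf g_m^{\mathsf H},\dots,\mathbf g_m\mathbf g_m^{\mathsf H})+\tfrac{\sigma_{\mathsf e}^2}{P}\mathbf I_{N(K+J)},\qquad \mathbf D_{m,k}=\mathbf C_{m,k}-\mathrm{blkdiag}(\mathbf 0,\dots,\mathbf g_m\mathbf g_m^{\mathsf H},\dots,\mathbf 0),$$ where in $\mathbf B_k$ and $\mathbf D_{m,k}$ the only nonzero subtracted block is in the $k$-th diagonal position. The vector $\bar{\mathbf v}$ stacks $K$ precoding vectors and $J$ artificial-noise vectors of $\mathbb C^N$. $\partial L/\partial\bar{\mathbf v}^{\mathsf H}$ denotes the Wirtinger derivative of the real-valued function $L$ with respect to the conjugate of $\bar{\mathbf v}$ (so for Hermitian $\mathbf Q$, $\partial(\bar{\mathbf v}^{\mathsf H}\mathbf Q\bar{\mathbf v})/\partial\bar{\mathbf v}^{\mathsf H}=\mathbf Q\bar{\mathbf v}$); its vanishing is equivalent to the vanishing of the real differential of $L$ on $\mathbb C^{N(K+J)}\cong\mathbb R^{2N(K+J)}$. The problem has no constraint on $\bar{\mathbf v}$, since $L$ is invariant under scaling of $\bar{\mathbf v}$. *)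

(* Defs.v *)
From mathcomp Require Import all_boot all_order all_algebra.
From mathcomp Require Import complex.
From mathcomp Require Import all_classical all_reals all_analysis.
Set Implicit Arguments.
Unset Strict Implicit.
Unset Printing Implicit Defensive.
Import Order.TTheory GRing.Theory Num.Theory.
Import numFieldNormedType.Exports.

Local Open Scope ring_scope.
Local Open Scope complex_scope.
Local Open Scope sesquilinear_scope.

Definition log2 (R : realType) (x : R) : R := ln x / ln 2.

(* The real number v^H Q v, for Hermitian Q (see [qformE]); the matrices it is
   applied to below are Hermitian by [loaded_blkdiag_herm] and
   [single_blkdiag_herm]. *)
Definition qform (R : realType) n (Q : 'M[R[i]]_n) (v : 'cV[R[i]]_n) : R :=
  complex.Re ((v ^t* *m Q *m v) 0 0).

Lemma qformE (R : realType) n (Q : 'M[R[i]]_n) (v : 'cV[R[i]]_n) :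
  Q ^t* = Q -> (qform Q v)%:C = (v ^t* *m Q *m v) 0 0.
Proof.
move=> hQ; set X := v ^t* *m Q *m v.
have hX : X ^t* = X.
  rewrite /X !trmx_mul !map_mxM /= trmxCK hQ.
  by rewrite mulmxA.
have : (X 0 0)^* = X 0 0 by rewrite -[in RHS]hX !mxE.
rewrite /qform -/X; case: (X 0 0) => a b [/eqP].
by rewrite eqNr => /eqP ->.
Qed.

(* [loaded_blkdiag K J a rho] is blkdiag(a a^H, ..., a a^H) + rho I, with
   K + J diagonal blocks of size N; its dimension \sum_(_ < K + J) N is
   N (K + J). *)
Definition loaded_blkdiag (R : realType) N K J (a : 'cV[R[i]]_N) (rho : R) :
    'M[R[i]]_(\sum_(i < K + J) N) :=
  \mxdiag_(i < K + J) (a *m a ^t*) + (rho%:C)%:M.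

(* The first K blocks belong to the precoders, the last J to the artificial
   noise: [lshift J k] is the k-th block position. *)
Definition single_blkdiag (R : realType) N K J (a : 'cV[R[i]]_N) (k : 'I_K) :
    'M[R[i]]_(\sum_(i < K + J) N) :=
  \mxdiag_(i < K + J) (if i == lshift J k then a *m a ^t* else 0).

Lemma mxdiag_herm (R : realType) N n (Q : 'I_n -> 'M[R[i]]_N) :
  (forall i, (Q i) ^t* = Q i) ->
  (\mxdiag_(i < n) Q i) ^t* = \mxdiag_(i < n) Q i.
Proof.
move=> hQ; rewrite tr_mxdiag; apply/matrixP => i j; rewrite !mxE.
case: eqP => [->|_]; last by rewrite !mxE conjC0.
by rewrite !conform_mx_id -[in RHS]hQ !mxE.
Qed.

Lemma outer_herm (R : realType) N (a : 'cV[R[i]]_N) :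
  (a *m a ^t*) ^t* = a *m a ^t*.
Proof. by rewrite trmx_mul map_mxM /= trmxCK. Qed.

Lemma loaded_blkdiag_herm (R : realType) N K J (a : 'cV[R[i]]_N) (rho : R) :
  (loaded_blkdiag K J a rho) ^t* = loaded_blkdiag K J a rho.
Proof.
rewrite /loaded_blkdiag linearD /= map_mxD tr_scalar_mx map_scalar_mx /=.
by congr (_ + _%:M); [apply: mxdiag_herm => i; exact: outer_herm
                     | exact: conjc_real].
Qed.

Lemma single_blkdiag_herm (R : realType) N K J (a : 'cV[R[i]]_N) (k : 'I_K) :
  (single_blkdiag J a k) ^t* = single_blkdiag J a k.
Proof.
apply: mxdiag_herm => i; case: ifP => _; first exact: outer_herm.
by apply/matrixP => s t; rewrite !mxE conjC0.
Qed.

Section Problem.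

Context (R : realType) (n K M : nat).
Context (alpha : R).
Context (A B : 'I_K -> 'M[R[i]]_n) (C D : 'I_M -> 'I_K -> 'M[R[i]]_n).
Implicit Type v : 'cV[R[i]]_n.

Definition beta : R := 1 / (alpha * ln 2).

Definition eve_ratio (m : 'I_M) (k : 'I_K) v : R :=
  (qform (C m k) v / qform (D m k) v) `^ beta.

Definition eve_sum (k : 'I_K) v : R := \sum_(m < M) eve_ratio m k v.

Definition objective v : R :=
  \sum_(k < K) (log2 (qform (A k) v / qform (B k) v)
                - alpha * ln (eve_sum k v)).

Definition lambda_num v : R := \prod_(k < K) qform (A k) v.

Definition lambda_den v : R :=
  \prod_(k < K) (eve_sum k v `^ alpha * qform (B k) v).

Definition lambda v : R := lambda_num v / lambda_den v.

Definition A_KKT v : 'M[R[i]]_n :=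
  (lambda_num v)%:C *: \sum_(k < K)
    (((1 / ln 2) * (qform (A k) v)^-1)%:C *: A k
     + (alpha / eve_sum k v)%:C *:
         \sum_(m < M) (beta * eve_ratio m k v / qform (D m k) v)%:C *: D m k).

Definition B_KKT v : 'M[R[i]]_n :=
  (lambda_den v)%:C *: \sum_(k < K)
    (((1 / ln 2) * (qform (B k) v)^-1)%:C *: B k
     + (alpha / eve_sum k v)%:C *:
         \sum_(m < M) (beta * eve_ratio m k v / qform (C m k) v)%:C *: C m k).

End Problem.

Section Wirtinger.

Context (R : realType) (n : nat).

Definition of_reim (p : 'cV[R]_n * 'cV[R]_n) : 'cV[R[i]]_n :=
  \col_j (p.1 j 0 +i* p.2 j 0).

Definition to_reim (v : 'cV[R[i]]_n) : 'cV[R]_n * 'cV[R]_n :=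
  (map_mx (@complex.Re R) v, map_mx (@complex.Im R) v).

(* Fréchet differentiability over R, under C^n = R^n x R^n. *)
Definition real_differentiable (f : 'cV[R[i]]_n -> R) (v : 'cV[R[i]]_n) :=
  differentiable (f \o of_reim) (to_reim v).

(* The column with j-th entry (1/2) (df/dx_j + i df/dy_j), where
   v_j = x_j + i y_j; it maps v^H Q v to Q v for Hermitian Q. The library's
   ['D_w f] is total, so this is only meaningful where f is
   [real_differentiable]. *)
Definition wirtinger (f : 'cV[R[i]]_n -> R) (v : 'cV[R[i]]_n) : 'cV[R[i]]_n :=
  \col_(j < n)
    ((2^-1)%:C *
       ('D_((delta_mx j 0, 0) : 'cV[R]_n * 'cV[R]_n)
          (f \o of_reim) (to_reim v)
        +i* 'D_((0, delta_mx j 0) : 'cV[R]_n * 'cV[R]_n)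
          (f \o of_reim) (to_reim v))).

End Wirtinger.

(* Main.v *)
(* The differential of v |-> v^H Q v along w is 2 Re (w^H Q v) for Hermitian Q.
   By the chain rule that of the objective is 2 Re (w^H G) with
   G = (A_KKT / lambda_num - B_KKT / lambda_den) v. All the quadratic forms are
   positive definite, since each A_k - (k-th block) still contains a positive
   multiple of the identity; hence B_KKT is invertible, and the eigenvalue
   equation reads A_KKT v = (lambda_num / lambda_den) B_KKT v, i.e. G = 0. *)
Require Import Defs.
From mathcomp Require Import all_boot all_order all_algebra.
From mathcomp Require Import complex.
From mathcomp Require Import all_classical all_reals all_analysis.
From mathcomp Require Import ring.
Set Implicit Arguments.
Unset Strict Implicit.
Unset Printing Implicit Defensive.
Import Order.TTheory GRing.Theory Num.Theory.
Import numFieldNormedType.Exports.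
Local Open Scope ring_scope.
Local Open Scope complex_scope.
Local Open Scope sesquilinear_scope.

(** * Differential calculus in a fixed direction *)

Section DirectionalDifferential.
Context (R : realType) (V : normedModType R) (p w : V).
Implicit Types (f g : V -> R) (a b c : R).

(** Differentiability is bundled with the value because ['d f p] is a total function and means
    nothing by itself. Fixing the point [p] and the direction [w] makes every rule below an identity
    between real numbers instead of linear maps. *)
Definition has_ddiff f a := differentiable f p /\ 'd f p w = a.

Lemma has_ddiff_cst c : has_ddiff (fun=> c) 0.
Proof. by split; [exact: differentiable_cst|rewrite diff_cst]. Qed.

Lemma has_ddiffD f g a b :
  has_ddiff f a -> has_ddiff g b -> has_ddiff (fun x => f x + g x) (a + b).
Proof.
move=> [df <-] [dg <-]; split; first exact: differentiableD.
by rewrite (diffD df dg).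
Qed.

Lemma has_ddiff_sum I (r : seq I) (F : I -> V -> R) (a : I -> R) :
  (forall i, has_ddiff (F i) (a i)) ->
  has_ddiff (fun x => \sum_(i <- r) F i x) (\sum_(i <- r) a i).
Proof.
move=> dF; elim: r => [|i r IH].
  under eq_fun do rewrite big_nil.
  by rewrite big_nil; exact: has_ddiff_cst.
under eq_fun do rewrite big_cons.
by rewrite big_cons; exact: has_ddiffD.
Qed.

Lemma has_ddiffM f g a b : has_ddiff f a -> has_ddiff g b ->
  has_ddiff (fun x => f x * g x) (f p * b + g p * a).
Proof.
move=> [df <-] [dg <-]; split; first exact: differentiableM.
by rewrite (diffM df dg).
Qed.

Lemma has_ddiff_comp (phi : R -> R) f a b :
  is_derive (f p) (1 : R) phi b -> has_ddiff f a ->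
  has_ddiff (fun x => phi (f x)) (b * a).
Proof.
move=> [dphi phiE] [df <-].
have dphi' : differentiable phi (f p) by exact/derivable1_diffP.
split; first exact: differentiable_comp.
(* On the real line the differential is multiplication by the derivative. *)
rewrite -/(phi \o f) (diff_comp df dphi') /= diff1E // derive1E phiE.
by rewrite /GRing.scale /= mulrC.
Qed.

Lemma has_ddiffZ c f a : has_ddiff f a -> has_ddiff (fun x => c * f x) (c * a).
Proof.
by move=> /(has_ddiffM (has_ddiff_cst c)); rewrite mulr0 addr0.
Qed.

Lemma has_ddiffV f a : f p != 0 -> has_ddiff f a ->
  has_ddiff (fun x => (f x)^-1) (- (f p) ^- 2 * a).
Proof.
move=> fp0 [df <-]; split; first exact: differentiableV.
by rewrite (diffV df fp0).
Qed.

Lemma has_ddiff_div f g a b : g p != 0 -> has_ddiff f a -> has_ddiff g b ->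
  has_ddiff (fun x => f x / g x) (a / g p - f p * b / g p ^+ 2).
Proof.
move=> gp0 df dg; have := has_ddiffM df (has_ddiffV gp0 dg).
by congr has_ddiff; field.
Qed.

End DirectionalDifferential.

(** * The real part of a sesquilinear form *)

Section SesquilinearForm.
Context (R : realType) (n : nat).
Implicit Types (Q : 'M[R[i]]_n) (u v w : 'cV[R[i]]_n) (x y : R[i]) (c : R).

Lemma ReD x y : complex.Re (x + y) = complex.Re x + complex.Re y.
Proof. by case: x y => [? ?] [? ?]. Qed.

Lemma Re_realM c x : complex.Re (c%:C * x) = c * complex.Re x.
Proof. by case: x => a b /=; rewrite mul0r subr0. Qed.

Lemma Re_conj x : complex.Re x^* = complex.Re x.
Proof. by case: x. Qed.

Lemma Re_sum I (r : seq I) (F : I -> R[i]) :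
  complex.Re (\sum_(i <- r) F i) = \sum_(i <- r) complex.Re (F i).
Proof. exact: (big_morph _ ReD). Qed.

(** Polar companion of [qform]: it is real-bilinear in the two vectors, convertible to [qform Q v]
    when they coincide, and for Hermitian [Q] it is half the differential of [qform Q] at [v] along
    [w]. *)
Definition hform Q w v : R := complex.Re ((w ^t* *m Q *m v) 0 0).

(** Moving [Q] onto the last vector turns linearity in the matrix into linearity in that vector. *)
Lemma hform_mulmx Q w v : hform Q w v = hform 1%:M w (Q *m v).
Proof. by rewrite /hform mulmx1 mulmxA. Qed.

Lemma hformDr Q w u v : hform Q w (u + v) = hform Q w u + hform Q w v.
Proof. by rewrite /hform mulmxDr mxE ReD. Qed.

Lemma hformZr Q w c v : hform Q w (c%:C *: v) = c * hform Q w v.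
Proof. by rewrite /hform -scalemxAr mxE Re_realM. Qed.

Lemma hformD Q1 Q2 w v : hform (Q1 + Q2) w v = hform Q1 w v + hform Q2 w v.
Proof. by rewrite hform_mulmx mulmxDl hformDr -!hform_mulmx. Qed.

Lemma hformZ Q w c v : hform (c%:C *: Q) w v = c * hform Q w v.
Proof. by rewrite hform_mulmx -scalemxAl hformZr -hform_mulmx. Qed.

Lemma hform_eigen Q1 Q2 c u v :
  Q1 *m v = c%:C *: (Q2 *m v) -> hform Q1 u v = c * hform Q2 u v.
Proof. by move=> eig; rewrite hform_mulmx eig hformZr -hform_mulmx. Qed.

Lemma hform_sum I (r : seq I) (F : I -> 'M[R[i]]_n) w v :
  hform (\sum_(i <- r) F i) w v = \sum_(i <- r) hform (F i) w v.
Proof.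
elim/big_rec2: _ => [|i c Q _ <-]; last exact: hformD.
by rewrite /hform mulmx0 mul0mx mxE.
Qed.

(** For Hermitian [Q] the two scalars are complex conjugates of each other, so their real parts
    agree. *)
Lemma hformC Q w v : Q ^t* = Q -> hform Q w v = hform Q v w.
Proof.
move=> hQ; rewrite /hform -[in RHS]Re_conj; congr complex.Re.
have -> : w ^t* *m Q *m v = (v ^t* *m Q *m w) ^t*.
  by rewrite !trmx_mul !map_mxM /= trmxCK hQ mulmxA.
by rewrite !mxE.
Qed.

(** Exact second-order expansion along a real line; the coefficient of [c] is the directional
    derivative. *)
Lemma qform_line Q c w v : Q ^t* = Q ->
  qform Q (v + c%:C *: w) =
    qform Q v + c * (hform Q w v *+ 2) + c ^+ 2 * qform Q w.
Proof.
move=> hQ; rewrite /qform -!/(hform _ _ _).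
have expand u : hform Q u (v + c%:C *: w) = hform Q u v + c * hform Q u w.
  by rewrite hformDr hformZr.
rewrite expand (hformC (v + _) v hQ) (hformC (v + _) w hQ) !expand.
rewrite (hformC v w hQ).
move: (hform Q v v) (hform Q w v) (hform Q w w) => a b d.
ring.
Qed.

(** A nonzero row [u] in the left kernel would give the nonzero column [u ^t*], at which the form is
    [u Q u^H = 0]. *)
Lemma unitmx_posdef Q : (forall v, v != 0 -> 0 < qform Q v) -> Q \in unitmx.
Proof.
move=> Qpos; rewrite -row_free_unit -kermx_eq0; apply/rowV0P => u.
move=> /sub_kermxP uQ0; apply/eqP; apply: contraT => u0.
have ut0 : u ^t* != 0.
  apply: contraNneq u0 => ut0; rewrite -[u]trmxCK ut0.
  by apply/eqP/matrixP => i j; rewrite !mxE conjC0.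
by have := Qpos _ ut0; rewrite /qform trmxCK uQ0 mul0mx mxE /= ltxx.
Qed.

End SesquilinearForm.

(** * Differential of a quadratic form in real coordinates *)

Section QuadraticDifferential.
Local Open Scope classical_set_scope.
Context (R : realType) (n : nat).
Implicit Types (Q : 'M[R[i]]_n) (p w : 'cV[R]_n * 'cV[R]_n).

Lemma to_reimK (v : 'cV[R[i]]_n) : of_reim (to_reim v) = v.
Proof.
by apply/matrixP => i j; rewrite !mxE (ord1 j) /=; case: (v i 0).
Qed.

Lemma of_reim_line p w (c : R) :
  of_reim (c *: w + p) = of_reim p + c%:C *: of_reim w.
Proof.
apply/matrixP => i j; rewrite !mxE; apply/eqP; rewrite eq_complex /=.
by rewrite !mul0r subr0 addr0 ![_ + c * _]addrC !eqxx.
Qed.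

Lemma differentiable_qform Q p : differentiable (qform Q \o @of_reim R n) p.
Proof.
have dfst j : differentiable (fun q : 'cV[R]_n * 'cV[R]_n => q.1 j 0) p.
  apply: (@differentiable_comp _ _ _ _ fst (fun M : 'cV[R]_n => M j 0)).
    by apply: (@linear_differentiable _ _ _ fst) => q; exact: cvg_fst.
  exact: differentiable_coord.
have dsnd j : differentiable (fun q : 'cV[R]_n * 'cV[R]_n => q.2 j 0) p.
  apply: (@differentiable_comp _ _ _ _ snd (fun M : 'cV[R]_n => M j 0)).
    by apply: (@linear_differentiable _ _ _ snd) => q; exact: cvg_snd.
  exact: differentiable_coord.
(* With [v = x + i y], the term [conj(v_k) Q_kj v_j] has real part [Re Q_kj (x_k x_j + y_k y_j) + Im
   Q_kj (y_k x_j - x_k y_j)], so the form is a polynomial in the coordinates. *)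
have -> : qform Q \o @of_reim R n = \sum_(j < n) \sum_(k < n)
    (fun q : 'cV[R]_n * 'cV[R]_n =>
              complex.Re (Q k j) * (q.1 k 0 * q.1 j 0 + q.2 k 0 * q.2 j 0) +
              complex.Im (Q k j) * (q.2 k 0 * q.1 j 0 - q.1 k 0 * q.2 j 0)).
  apply/funext => q; rewrite fct_sumE /= /qform mxE Re_sum.
  apply: eq_bigr => j _; rewrite fct_sumE mxE mulr_suml Re_sum.
  apply: eq_bigr => k _; rewrite !mxE.
  case: (Q k j) => a b /=; ring.
apply: differentiable_sum => j; apply: differentiable_sum => k.
have cM c (f : 'cV[R]_n * 'cV[R]_n -> R) :
    differentiable f p -> differentiable (fun q => c * f q) p.
  by move=> df; apply: differentiableZ.
apply: differentiableD; apply: cM.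
  by apply: differentiableD; apply: differentiableM.
by apply: differentiableB; apply: differentiableM.
Qed.

Lemma has_ddiff_qform Q p w : Q ^t* = Q ->
  has_ddiff p w (fun q => qform Q (of_reim q))
    (hform Q (of_reim w) (of_reim p) *+ 2).
Proof.
move=> hQ; have dQ := differentiable_qform Q p; split => //.
rewrite -(deriveE w dQ) /derive.
set a := hform _ _ _ *+ 2; pose b := qform Q (of_reim w).
apply: cvg_lim => //.
(* By [qform_line] the difference quotient is exactly [a + c * b] for [c != 0], which tends to
   [a]. *)
apply: (@cvg_trans _ ((fun c : R => a + c * b) @ 0^')).
  apply: near_eq_cvg; near=> c.
  have c0 : c != 0 by near: c; exact: nbhs_dnbhs_neq.
  rewrite /= of_reim_line qform_line // -/a -/b /GRing.scale /=.
  move: (qform Q _) a b => q a b.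
  rewrite -[q + _ + _]addrA addrAC subrr add0r expr2 -mulrA -mulrDr.
  by rewrite mulrA mulVf // mul1r.
have ac : (fun c : R => a + c * b) @ 0^' --> a + 0 * b.
  apply: cvgD; first exact: cvg_cst.
  by apply: cvgMl; apply: cvg_within_filter; exact: cvg_id.
by rewrite mul0r addr0 in ac.
Unshelve. all: by end_near. Qed.

End QuadraticDifferential.

Lemma sum_ord_gt0 (R : numDomainType) n (F : 'I_n -> R) : (0 < n)%N ->
  (forall i, 0 < F i) -> 0 < \sum_(i < n) F i.
Proof.
case: n F => // n F _ F0; rewrite big_ord_recl ltr_pwDl //.
by apply: sumr_ge0 => i _; exact: ltW.
Qed.

Lemma ln2_gt0 (R : realType) : 0 < ln 2 :> R.
Proof. by rewrite ln_gt0 // ltr1n. Qed.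

(** * The stationarity condition for arbitrary families of Hermitian positive definite matrices *)

Section Stationarity.
Context (R : realType) (n K M : nat) (alpha : R).
Context (A B : 'I_K -> 'M[R[i]]_n) (C D : 'I_M -> 'I_K -> 'M[R[i]]_n).
Context (hermA : forall k, (A k) ^t* = A k)
  (hermB : forall k, (B k) ^t* = B k)
  (hermC : forall m k, (C m k) ^t* = C m k)
  (hermD : forall m k, (D m k) ^t* = D m k).
Context (posA : forall k v, v != 0 -> 0 < qform (A k) v)
  (posB : forall k v, v != 0 -> 0 < qform (B k) v)
  (posC : forall m k v, v != 0 -> 0 < qform (C m k) v)
  (posD : forall m k v, v != 0 -> 0 < qform (D m k) v).
Context (K_gt0 : (0 < K)%N) (M_gt0 : (0 < M)%N) (alpha_gt0 : 0 < alpha).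
Context (v : 'cV[R[i]]_n) (v_neq0 : v != 0).

Let r m k := eve_ratio alpha C D m k v.
Let S k := eve_sum alpha C D k v.
Let b := beta alpha.

Lemma eve_ratio_gt0 m k : 0 < r m k.
Proof. by rewrite powR_gt0 // divr_gt0 ?posC ?posD. Qed.

Lemma eve_sum_gt0 k : 0 < S k.
Proof. by apply: sum_ord_gt0 => // m; exact: eve_ratio_gt0. Qed.

Lemma lambda_num_gt0 : 0 < lambda_num A v.
Proof. by apply: prodr_gt0 => k _; exact: posA. Qed.

Lemma lambda_den_gt0 : 0 < lambda_den alpha B C D v.
Proof.
apply: prodr_gt0 => k _; rewrite mulr_gt0 ?posB // powR_gt0 //.
exact: eve_sum_gt0.
Qed.

Lemma hform_A_KKT u : hform (A_KKT alpha A C D v) u v =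
  lambda_num A v * \sum_(k < K)
    ((1 / ln 2) * (qform (A k) v)^-1 * hform (A k) u v +
     alpha / S k * \sum_(m < M)
       b * r m k / qform (D m k) v * hform (D m k) u v).
Proof.
rewrite hformZ hform_sum; congr (_ * _); apply: eq_bigr => k _.
rewrite hformD !hformZ hform_sum; congr (_ + _ * _).
by apply: eq_bigr => m _; rewrite hformZ.
Qed.

(** The second vector is left free, unlike in [hform_A_KKT]: invertibility of [B_KKT] uses both
    slots at an arbitrary [w], the eigenvalue equation uses [v] in the second one. *)
Lemma hform_B_KKT u w : hform (B_KKT alpha B C D v) u w =
  lambda_den alpha B C D v * \sum_(k < K)
    ((1 / ln 2) * (qform (B k) v)^-1 * hform (B k) u w +
     alpha / S k * \sum_(m < M)
       b * r m k / qform (C m k) v * hform (C m k) u w).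
Proof.
rewrite hformZ hform_sum; congr (_ * _); apply: eq_bigr => k _.
rewrite hformD !hformZ hform_sum; congr (_ + _ * _).
by apply: eq_bigr => m _; rewrite hformZ.
Qed.

(** The weights are evaluated at [v] and are positive there, while the form is tested at an
    arbitrary [w]: a positive combination of positive definite matrices is positive definite. *)
Lemma B_KKT_unit : B_KKT alpha B C D v \in unitmx.
Proof.
apply: unitmx_posdef => w w0; rewrite [qform _ _]hform_B_KKT.
have b_gt0 : 0 < b by rewrite divr_gt0 // mulr_gt0 // ln2_gt0.
rewrite mulr_gt0 ?lambda_den_gt0 // sum_ord_gt0 // => k.
have qB0 : 0 < (qform (B k) v)^-1 by rewrite invr_gt0 posB.
rewrite ltr_pwDl //.
  by rewrite !mulr_gt0 ?posB // invr_gt0 ln2_gt0.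
rewrite mulr_ge0 ?divr_ge0 ?ltW ?eve_sum_gt0 // sum_ord_gt0 // => m.
by rewrite mulr_gt0 ?posC // divr_gt0 ?posC // mulr_gt0 ?eve_ratio_gt0.
Qed.

(** The chain rule is applied from the inside out: quotients, powers, sum over eavesdroppers,
    logarithms. Each quotient contributes its logarithmic derivative, a difference of two terms, and
    these later separate into the [A_KKT] and [B_KKT] parts. *)
Lemma has_ddiff_objective w : has_ddiff (to_reim v) w
  (objective alpha A B C D \o @of_reim R n)
  (\sum_(k < K)
    ((1 / ln 2) * (hform (A k) (of_reim w) v *+ 2 / qform (A k) v -
                   hform (B k) (of_reim w) v *+ 2 / qform (B k) v) -
     alpha * ((S k)^-1 * \sum_(m < M) b * r m k *
        (hform (C m k) (of_reim w) v *+ 2 / qform (C m k) v -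
         hform (D m k) (of_reim w) v *+ 2 / qform (D m k) v)))).
Proof.
have dq (Q : 'M[R[i]]_n) : Q ^t* = Q ->
    has_ddiff (to_reim v) w (fun q => qform Q (of_reim q))
      (hform Q (of_reim w) v *+ 2).
  by move=> hQ; have := has_ddiff_qform (to_reim v) w hQ; rewrite to_reimK.
have dratio (P Q : 'M[R[i]]_n) : P ^t* = P -> Q ^t* = Q -> 0 < qform Q v ->
    has_ddiff (to_reim v) w (fun q => qform P (of_reim q) / qform Q (of_reim q))
      (hform P (of_reim w) v *+ 2 / qform Q v
       - qform P v * (hform Q (of_reim w) v *+ 2) / qform Q v ^+ 2).
  move=> hP hQ Q0; have := has_ddiff_div _ (dq _ hP) (dq _ hQ).
  by rewrite to_reimK; apply; rewrite gt_eqF.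
have deve m k : has_ddiff (to_reim v) w
    (fun q => eve_ratio alpha C D m k (of_reim q))
    (b * r m k * (hform (C m k) (of_reim w) v *+ 2 / qform (C m k) v -
         hform (D m k) (of_reim w) v *+ 2 / qform (D m k) v)).
  have C0 := posC m k v_neq0; have D0 := posD m k v_neq0.
  have x0 := divr_gt0 C0 D0.
  have := has_ddiff_comp _ (dratio _ _ (hermC m k) (hermD m k) D0).
  rewrite to_reimK => /(_ _ _ (is_derive1_powR b x0)); congr has_ddiff.
  (* The derivative [b x^(b-1)] becomes [b x^b / x], which brings back [r m k]; the ratio [x] is
     positive. *)
  rewrite powRB ?(gt_eqF x0) ?implybT // powRr1 ?ltW // -/(r m k).
  move: (hform _ _ _ *+ 2) (hform _ _ _ *+ 2) => dC dD.
  rewrite -[_ `^ _]/(r m k); move: (r m k) => rmk.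
  move: (qform _ _) (qform _ _) C0 D0 {x0} => qC qD C0 D0.
  by field; rewrite !gt_eqF.
have dS k : has_ddiff (to_reim v) w
    (fun q => ln (eve_sum alpha C D k (of_reim q)))
    ((S k)^-1 * \sum_(m < M) b * r m k *
        (hform (C m k) (of_reim w) v *+ 2 / qform (C m k) v -
         hform (D m k) (of_reim w) v *+ 2 / qform (D m k) v)).
  apply: (has_ddiff_comp _ (has_ddiff_sum _ (fun m => deve m k))).
  by rewrite to_reimK; exact: is_derive1_ln (eve_sum_gt0 k).
have dlog k : has_ddiff (to_reim v) w
    (fun q => log2 (qform (A k) (of_reim q) / qform (B k) (of_reim q)))
    ((1 / ln 2) * (hform (A k) (of_reim w) v *+ 2 / qform (A k) v -
                   hform (B k) (of_reim w) v *+ 2 / qform (B k) v)).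
  have A0 := posA k v_neq0; have B0 := posB k v_neq0.
  have x0 := divr_gt0 A0 B0.
  have := has_ddiff_comp _ (dratio _ _ (hermA k) (hermB k) B0).
  rewrite to_reimK => /(_ _ _ (is_derive1_ln x0)).
  move=> /(has_ddiffZ (ln 2)^-1).
  have -> : (fun q => (ln 2)^-1 *
        ln (qform (A k) (of_reim q) / qform (B k) (of_reim q)))
      = (fun q => log2 (qform (A k) (of_reim q) / qform (B k) (of_reim q))).
    by apply/funext => q; rewrite mulrC.
  congr has_ddiff.
  move: (hform _ _ _ *+ 2) (hform _ _ _ *+ 2) => dA dB.
  move: (qform _ _) (qform _ _) A0 B0 {x0} => qA qB A0 B0.
  move: (ln 2) (ln2_gt0 R) => l l0.
  by field; rewrite !gt_eqF.
apply: has_ddiff_sum => k; apply: (has_ddiffD (dlog k)).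
by rewrite -mulNr; under eq_fun do rewrite -mulNr; exact: has_ddiffZ.
Qed.

Lemma stationary_of_KKT :
  invmx (B_KKT alpha B C D v) *m A_KKT alpha A C D v *m v
    = (lambda alpha A B C D v)%:C *: v ->
  real_differentiable (objective alpha A B C D) v /\
  wirtinger (objective alpha A B C D) v = 0.
Proof.
move=> eig; have dL := has_ddiff_objective.
split; first by have [] := dL 0.
have AB : A_KKT alpha A C D v *m v
        = (lambda alpha A B C D v)%:C *: (B_KKT alpha B C D v *m v).
  (* Multiplying the hypothesis by [B_KKT] on the left removes the inverse. *)
  by rewrite scalemxAr -eig !mulmxA mulmxV ?B_KKT_unit // mul1mx.
have D0 w : 'D_w (objective alpha A B C D \o @of_reim R n) (to_reim v) = 0.
  have [df dfE] := dL w; rewrite deriveE // dfE.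
  have := hform_eigen (of_reim w) AB.
  (* The denominator of [lambda] cancels the prefactor of [B_KKT]. Both sides then carry the factor
     [lambda_num], which is positive and cancels too. *)
  rewrite hform_A_KKT hform_B_KKT mulrA /lambda.
  move: (lambda_num A v) (lambda_den _ _ _ _ v) lambda_num_gt0 lambda_den_gt0.
  move=> num den num0 den0; rewrite (divfK (lt0r_neq0 den0)).
  move=> /(mulfI (lt0r_neq0 num0)) /eqP; rewrite -subr_eq0 => /eqP.
  (* Twice the difference of the two remaining sums is the differential of the objective, as is now
     checked for each user [k]. *)
  move=> /(congr1 (fun x => x *+ 2)); rewrite mul0rn; apply: etrans.
  rewrite -sumrB -sumrMnl; apply: eq_bigr => k _.
  (* The [C] terms match those of [B_KKT] and the [D] terms those of [A_KKT]; the minus sign in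
     front of [alpha] gives each its side. *)
  have -> : \sum_(m < M) b * r m k *
        (hform (C m k) (of_reim w) v *+ 2 / qform (C m k) v -
         hform (D m k) (of_reim w) v *+ 2 / qform (D m k) v) =
      (\sum_(m < M) b * r m k / qform (C m k) v * hform (C m k) (of_reim w) v -
       \sum_(m < M) b * r m k / qform (D m k) v * hform (D m k) (of_reim w) v)
      *+ 2.
    rewrite -sumrB -sumrMnl; apply: eq_bigr => m _.
    by move: (qform _ _)^-1 (qform _ _)^-1 => qC qD; ring.
  move: (\sum_(m < M) _) (\sum_(m < M) _) (qform _ _)^-1 (qform _ _)^-1.
  by move: (S k)^-1 (1 / ln 2) => s l sC sD qA qB; ring.
(* Both partial derivatives in each entry are directional derivatives, hence zero. *)
apply/matrixP => j l; rewrite !mxE !D0.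
by apply/eqP; rewrite eq_complex /= !mulr0 subr0 addr0 eqxx.
Qed.

End Stationarity.

(** * Positivity of the block-diagonal matrices *)

Section BlockDiagonal.
Context (R : realType).

Lemma Re_conjM_ge0 (x : R[i]) : 0 <= complex.Re (x^* * x).
Proof.
by case: x => a b /=; rewrite mulNr opprK addr_ge0 // -expr2 sqr_ge0.
Qed.

Lemma Re_conjM_gt0 (x : R[i]) : x != 0 -> 0 < complex.Re (x^* * x).
Proof.
rewrite lt_def Re_conjM_ge0 andbT; apply: contraNneq; case: x => a b /=.
rewrite mulNr opprK -!expr2 => /eqP; rewrite paddr_eq0 ?sqr_ge0 // !sqrf_eq0.
by rewrite eq_complex.
Qed.

Lemma qform_scalar_gt0 n (rho : R) (v : 'cV[R[i]]_n) :
  0 < rho -> v != 0 -> 0 < qform (rho%:C%:M) v.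
Proof.
move=> rho0 v0; have [j vj] : exists j, v j 0 != 0.
  apply/existsP; apply: contraNT v0 => /existsPn v0; apply/eqP/matrixP => j l.
  by rewrite (ord1 l) mxE; apply/eqP; rewrite -[_ == _]negbK.
rewrite /qform mul_mx_scalar -scalemxAl mxE Re_realM mulr_gt0 //.
rewrite mxE Re_sum (bigD1 j) //= ltr_pwDl //.
  by rewrite !mxE; exact: Re_conjM_gt0.
by apply: sumr_ge0 => l _; rewrite !mxE; exact: Re_conjM_ge0.
Qed.

(** The form is the squared modulus of the scalar [a^H u]. *)
Lemma qform_outer_ge0 n (a u : 'cV[R[i]]_n) : 0 <= qform (a *m a ^t*) u.
Proof.
have -> : qform (a *m a ^t*) u
        = complex.Re (((a ^t* *m u) ^t* *m (a ^t* *m u)) 0 0).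
  by rewrite /qform trmx_mul map_mxM /= trmxCK !mulmxA.
by rewrite mxE big_ord1 !mxE; exact: Re_conjM_ge0.
Qed.

Lemma qform_mxdiag N n (Q : 'I_n -> 'M[R[i]]_N)
    (v : 'cV[R[i]]_(\sum_(i < n) N)) :
  qform (\mxdiag_i Q i) v = \sum_i qform (Q i) (submxcol v i).
Proof.
rewrite /qform -[in LHS](submxcolK v).
have -> : (\mxcol_i submxcol v i) ^t* = \mxrow_i (submxcol v i) ^t*.
  by apply/matrixP => i j; rewrite !mxE.
rewrite -mulmxA mul_mxdiag_mxcol mul_mxrow_mxcol summxE Re_sum.
by apply: eq_bigr => i _; rewrite mulmxA.
Qed.

(** The predicate [b] marks the erased blocks, so that one statement serves both kinds of matrices:
    [pred0] for [A] and [C], a singleton for [B] and [D]. The blocks contribute a non-negative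
    amount and the multiple of the identity a positive one. *)
Lemma qform_blkdiag_gt0 N n (a : 'cV[R[i]]_N) (b : pred 'I_n) (rho : R)
    (v : 'cV[R[i]]_(\sum_(i < n) N)) : 0 < rho -> v != 0 ->
  0 < qform (\mxdiag_i (if b i then 0 else a *m a ^t*) + rho%:C%:M) v.
Proof.
move=> rho0 v0; rewrite /qform -/(hform _ _ _) hformD ltr_wpDl //.
  rewrite -[hform _ _ _]/(qform _ _) qform_mxdiag; apply: sumr_ge0 => i _.
  case: (b i); last exact: qform_outer_ge0.
  by rewrite /qform mulmx0 mul0mx mxE.
exact: qform_scalar_gt0.
Qed.

Lemma loaded_blkdiag_gt0 N K J (a : 'cV[R[i]]_N) (rho : R)
    (v : 'cV[R[i]]_(\sum_(i < K + J) N)) : 0 < rho -> v != 0 ->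
  0 < qform (loaded_blkdiag K J a rho) v.
Proof. exact: (@qform_blkdiag_gt0 _ _ a pred0). Qed.

Lemma loaded_sub_single_gt0 N K J (a : 'cV[R[i]]_N) (k : 'I_K) (rho : R)
    (v : 'cV[R[i]]_(\sum_(i < K + J) N)) : 0 < rho -> v != 0 ->
  0 < qform (loaded_blkdiag K J a rho - single_blkdiag J a k) v.
Proof.
(* The scalar matrix is moved last, so that the two block diagonals merge and the [k]-th block
   cancels. *)
rewrite /loaded_blkdiag /single_blkdiag addrAC -mxdiagB.
have -> : \mxdiag_(i < K + J)
      (a *m a ^t* - (if i == lshift J k then a *m a ^t* else 0))
    = \mxdiag_(i < K + J) (if i == lshift J k then 0 else a *m a ^t*).
  by apply: eq_mxdiag => i; case: ifP; rewrite ?subrr ?subr0.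
exact: (@qform_blkdiag_gt0 _ _ a (pred1 _)).
Qed.

Lemma loaded_sub_single_herm N K J (a : 'cV[R[i]]_N) (k : 'I_K) (rho : R) :
  (loaded_blkdiag K J a rho - single_blkdiag J a k) ^t* =
  loaded_blkdiag K J a rho - single_blkdiag J a k.
Proof.
by rewrite linearB map_mxB /= loaded_blkdiag_herm single_blkdiag_herm.
Qed.

End BlockDiagonal.

(** * The first-order condition for the given channels *)

Theorem lemma1 (R : realType) (N K J M : nat)
  (N_gt0 : (0 < N)%N) (K_gt0 : (0 < K)%N) (M_gt0 : (0 < M)%N)
  (P sigma2 sigmae2 alpha : R)
  (P_gt0 : 0 < P) (sigma2_gt0 : 0 < sigma2) (sigmae2_gt0 : 0 < sigmae2)
  (alpha_gt0 : 0 < alpha)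
  (h : 'I_K -> 'cV[R[i]]_N) (g : 'I_M -> 'cV[R[i]]_N)
  (v : 'cV[R[i]]_(\sum_(i < K + J) N)) (v_neq0 : v != 0) :
  let A k := loaded_blkdiag K J (h k) (sigma2 / P) in
  let B k := A k - single_blkdiag J (h k) k in
  let C m (k : 'I_K) := loaded_blkdiag K J (g m) (sigmae2 / P) in
  let D m k := C m k - single_blkdiag J (g m) k in
  invmx (B_KKT alpha B C D v) *m A_KKT alpha A C D v *m v
    = (lambda alpha A B C D v)%:C *: v ->
  real_differentiable (objective alpha A B C D) v /\
  wirtinger (objective alpha A B C D) v = 0.
Proof.
move=> A B C D.
have rhoA : 0 < sigma2 / P by rewrite divr_gt0.
have rhoC : 0 < sigmae2 / P by rewrite divr_gt0.
(* What remains is that the four families are Hermitian and positive definite; the positive loads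
   [rhoA] and [rhoC] give the latter. *)
apply: stationary_of_KKT => //.
- by move=> k; exact: loaded_blkdiag_herm.
- by move=> k; exact: loaded_sub_single_herm.
- by move=> m k; exact: loaded_blkdiag_herm.
- by move=> m k; exact: loaded_sub_single_herm.
- by move=> k u; exact: loaded_blkdiag_gt0.
- by move=> k u; exact: loaded_sub_single_gt0.
- by move=> m k u; exact: loaded_blkdiag_gt0.
- by move=> m k u; exact: loaded_sub_single_gt0.
Qed.
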